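(* Let $s\ge 2$, $k\ge s+1$ and $n\ge k+1$ be integers. The total number of occurrences of the form $a(a+s)$ in all the members of $\mathcal{P}_{n,k}$ is $$(k-s)S(n-1,k)+\sum_{j=s+1}^k\sum_{t=0}^{n-k-2}S(n-t-2,k)\,j^t(j-s).$$
   Context: $\mathcal{P}_{n,k}$ is the set of partitions of $[n]=\{1,\dots,n\}$ into $k$ nonempty blocks, and $S(n,k)=|\mathcal{P}_{n,k}|$ is the Stirling number of the second kind. A partition with blocks $T_1,\dots,T_k$, ordered so that $\min T_1<\cdots<\min T_k$, is identified with its sequential form $\pi=\pi_1\cdots\pi_n$, where $i\in T_{\pi_i}$. An occurrence of $a(a+s)$ in $\pi$ is an index $i\in\{1,\dots,n-1\}$ with $\pi_{i+1}-\pi_i=s$; the total is the sum over all $\pi\in\mathcal{P}_{n,k}$ of the number of occurrences in $\pi$. Empty sums equal $0$. *)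

(* Defs.v *)
From mathcomp Require Import all_boot.

Set Implicit Arguments.
Unset Strict Implicit.
Unset Printing Implicit Defensive.

(* The ordinal i : 'I_n stands for the element i + 1 of [n] = {1, ..., n}. *)

Definition set_partitions (n k : nat) : {set {set {set 'I_n}}} :=
  [set P : {set {set 'I_n}} | partition P [set: 'I_n] & #|P| == k].

Definition stirling2 (n k : nat) : nat := #|set_partitions n k|.

(* The default value n is only taken by the empty set, never by a block. *)
Definition block_min n (B : {set 'I_n}) : nat := \big[minn/n]_(i in B) i.

(* The blocks T_1, ..., T_k, listed so that min T_1 < ... < min T_k. *)
Definition ordered_blocks n (P : {set {set 'I_n}}) : seq {set 'I_n} :=
  sort (fun B C => block_min B <= block_min C) (enum P).

(* Block labels start at 1, positions in the sequence start at 0. *)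
Definition sequential_form n (P : {set {set 'I_n}}) : seq nat :=
  [seq (find (fun B : {set 'I_n} => i \in B) (ordered_blocks P)).+1
  | i <- enum 'I_n].

Definition occurrences (s : nat) (w : seq nat) : nat :=
  #|[set i : 'I_(size w).-1 | nth 0 w i.+1 == nth 0 w i + s]|.

Definition total_occurrences (n k s : nat) : nat :=
  \sum_(P in set_partitions n k) occurrences s (sequential_form P).

(* Main.v *)
Require Import Defs.
From mathcomp Require Import all_boot zify ring.

Set Implicit Arguments.
Unset Strict Implicit.
Unset Printing Implicit Defensive.

(** The sequential forms of the partitions of [n] into k blocks are the words of
    length n on the letters 1, ..., k in which every letter occurs and the first
    occurrences come in increasing order (restricted growth words), and each
    such word comes from exactly one partition; this is
    [perm_sequential_form].  Hence S(n, k) and the total number of occurrences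
    can be read off the list [growth_words n k], which grows by its last letter:
    append any of the k letters to a word that already uses all of them, or
    append k to a word on k - 1 letters.

    An appended letter b creates an occurrence of a(a+s) exactly when the
    previous letter is b - s.  As s >= 2, that letter is smaller than the largest
    letter of the word, so it did not enter the word as a new maximum: it was
    appended freely, and S(n, k) of the words of length n + 1 on k letters end
    with it ([last_growth_words]).  This gives, for the totals T, the recurrence
    [total_occurrencesSS]
      T(n+2, k+1) = (k+1) T(n+1, k+1) + T(n+1, k)
                    + (k+1-s) S(n, k+1) + [s <= k] S(n, k).

    The closed form satisfies the same recurrence.  Its two terms separate the
    occurrences whose second letter is new (removing the first letter leaves a
    word of length n - 1 and one of k - s possible values) from those whose two
    letters are both old: if j letters have appeared so far there are j - s
    choices for the pair, and removing it leaves a word of length n - 2 with a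
    marked cut before which the letters are 1, ..., j.  The number of words with
    such a cut is [split_words (n - 1) k j].  The values of t that the theorem
    omits from this sum contribute Stirling numbers S(m, k) with m < k. *)

(** * Least elements of blocks *)

Lemma block_min_le n (B : {set 'I_n}) i : i \in B -> block_min B <= i.
Proof.
rewrite /block_min -big_filter => iB.
have : i \in [seq j <- index_enum 'I_n | j \in B].
  by rewrite mem_filter iB mem_index_enum.
elim: [seq _ <- _ | _] => // j r IH; rewrite big_cons inE geq_min.
by case/orP=> [/eqP->|/IH->]; rewrite ?leqnn ?orbT.
Qed.

Lemma block_min_eq n (B : {set 'I_n}) (i : 'I_n) :
  i \in B -> (forall j, j \in B -> i <= j) -> block_min B = i.
Proof.
move=> iB leB; apply/eqP; rewrite eqn_leq block_min_le //=.
apply: (big_ind (fun m => i <= m)) => // [|x y lex ley]; first exact: ltnW.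
by rewrite leq_min lex.
Qed.

Lemma block_min_mem n (B : {set 'I_n}) :
  B != set0 -> exists2 i, i \in B & block_min B = i.
Proof.
case/set0Pn=> i0 i0B; case: (arg_minnP (fun i : 'I_n => i : nat) i0B) => i iB le_i.
by exists i => //; apply: block_min_eq.
Qed.

(** * Restricted growth words *)
Definition level_set (n : nat) (w : seq nat) (a : nat) : {set 'I_n} :=
  [set i : 'I_n | nth 0 w i == a].

(** The bridge between the two orderings: comparing blocks by their least
    elements is comparing letters by their first occurrences. *)
Lemma block_min_level_set (w : seq nat) a :
  a \in w -> block_min (level_set (size w) w a) = index a w.
Proof.
move=> aw; have lt_w : index a w < size w by rewrite index_mem.
apply: (@block_min_eq _ _ (Ordinal lt_w)) => [|j].
  by rewrite inE /= nth_index.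
rewrite inE /= => /eqP <-; rewrite leqNgt; apply/negP => lt_j.
by move/(before_find 0): lt_j; rewrite /= eqxx.
Qed.

Lemma first_occurrences_sorted (w : seq nat) :
  sorted ltn [seq index a w | a <- rev (undup (rev w))].
Proof.
rewrite (sorted_pairwise ltn_trans) pairwise_map.
elim/last_ind: w => // w x IH; rewrite rev_rcons /= mem_rev.
have idx a : a \in w -> index a (rcons w x) = index a w.
  by move=> aw; rewrite -cats1 index_cat aw.
have mem_u a : a \in rev (undup (rev w)) -> a \in w.
  by rewrite mem_rev mem_undup mem_rev.
have pw : pairwise (relpre (index^~ (rcons w x)) ltn) (rev (undup (rev w))).
  rewrite (@eq_in_pairwise _ (mem w) _ (relpre (index^~ w) ltn)) //.
    by move=> a b aw bw /=; rewrite !idx.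
  by apply/allP => a /mem_u.
case: (boolP (x \in w)) => [//|xw]; rewrite rev_cons pairwise_rcons pw andbT.
apply/allP => a /mem_u aw /=.
by rewrite idx // -cats1 index_cat (negPf xw) /= eqxx addn0 index_mem.
Qed.

(** [undup] keeps last occurrences, so on the reversed word it lists the letters
    by first occurrence, latest first.  In this form the effect of appending a
    letter is a single unfolding of [undup]. *)
Definition restricted_growth k w := undup (rev w) == rev (iota 1 k).

Lemma restricted_growth_mem k w : restricted_growth k w -> w =i iota 1 k.
Proof.
by move/eqP=> e a; rewrite -mem_rev -mem_undup e mem_rev.
Qed.

(** A list of letters sorted by first occurrence is determined by its set of
    members, so the order in which the letters appear need only be checked on
    [iota 1 k].  This form is the one that compares with the ordering of the
    blocks of a partition. *)
Lemma restricted_growthP k w :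
  reflect (w =i iota 1 k /\ sorted ltn [seq index a w | a <- iota 1 k])
          (restricted_growth k w).
Proof.
apply: (iffP idP) => [g|[e srt]].
  split; first exact: restricted_growth_mem.
  by rewrite -[iota 1 k]revK -(eqP g) first_occurrences_sorted.
rewrite /restricted_growth -[undup _]revK; apply/eqP; congr rev.
pose r := relpre (index^~ w) ltn.
apply: (@irr_sorted_eq _ r) => [b a c|a|||a].
- exact: ltn_trans.
- exact: ltnn.
- by rewrite -sorted_map first_occurrences_sorted.
- by rewrite -sorted_map.
- by rewrite mem_rev mem_undup mem_rev e.
Qed.

Fixpoint growth_words (n k : nat) : seq (seq nat) :=
  if n is m.+1 then
    [seq rcons w a | w <- growth_words m k, a <- iota 1 k] ++
    (if k is l.+1 then [seq rcons w k | w <- growth_words m l] else [::])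
  else if k is 0 then [:: [::]] else [::].

Lemma growth_wordsS0 n : growth_words n.+1 0 = [::].
Proof. by rewrite /= cats0; elim: (growth_words n 0). Qed.

Lemma growth_wordsSS n k :
  growth_words n.+1 k.+1 =
    [seq rcons w a | w <- growth_words n k.+1, a <- iota 1 k.+1] ++
    [seq rcons w k.+1 | w <- growth_words n k].
Proof. by []. Qed.

(** The appended letter is either one of the letters already present, or new,
    and then it must be the largest. *)
Lemma restricted_growth_rcons k w a :
  restricted_growth k (rcons w a) =
  (restricted_growth k w && (a \in iota 1 k)) ||
  [&& 0 < k, a == k & restricted_growth k.-1 w].
Proof.
rewrite /restricted_growth rev_rcons /=.
have iotaSr l : rev (iota 1 l.+1) = l.+1 :: rev (iota 1 l).
  by rewrite -{1}(addn1 l) iotaD rev_cat /= add1n.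
rewrite -(mem_rev (iota 1 k)) -(mem_undup (rev w)).
have [aw|aw] := boolP (a \in undup (rev w)).
  have [<-|ne] := eqVneq (undup (rev w)) (rev (iota 1 k)); first by rewrite aw.
  symmetry; case: k ne => //= k _; apply/negP => /andP[/eqP ak /eqP e].
  by move: aw; rewrite e ak mem_rev mem_iota add1n ltnn andbF.
have -> : (undup (rev w) == rev (iota 1 k)) && (a \in rev (iota 1 k)) = false.
  by apply/negP => /andP[/eqP <-]; apply/negP.
by case: k => [|k] //; rewrite iotaSr eqseq_cons.
Qed.

Lemma mem_growth_words n k w :
  (w \in growth_words n k) = (size w == n) && restricted_growth k w.
Proof.
elim: n k w => [|n IH] k w.
  case: w => [|a w]; last by case: k.
  by case: k => //= k; rewrite /restricted_growth -(addn1 k) iotaD rev_cat.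
case/lastP: w => [|w a] /=.
  rewrite mem_cat; apply/norP; split; first by apply/allpairsP => -[[[|? ?] ?] []].
  by case: k => // k; apply/mapP => -[[]].
rewrite size_rcons eqSS restricted_growth_rcons mem_cat andb_orr; congr (_ || _).
  rewrite andbA -IH; apply/allpairsP/andP => [[[w' a'] /= [w'W a'k e]]|[wW ak]].
    by case: (rcons_inj e) => -> ->.
  by exists (w, a).
case: k => [|k]; first by rewrite andbF.
rewrite /= andbCA -IH; apply/mapP/andP => [[w' w'W e]|[/eqP-> wW]].
  by case: (rcons_inj e) => -> ->.
by exists w.
Qed.

Lemma growth_words_uniq n k : uniq (growth_words n k).
Proof.
elim: n k => [|n IH] k /=; first by case: k.
rewrite cat_uniq; apply/and3P; split.
- apply: allpairs_uniq => //; first exact: iota_uniq.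
  by move=> [w a] [w' a'] _ _ /= /rcons_inj[-> ->].
(* The two ways to append a letter are exclusive: the letter k.+1 occurs in w
   for the first kind, and does not for the second. *)
- case: k => // k; apply/hasPn => _ /mapP[w + ->].
  rewrite mem_growth_words => /andP[_ g].
  apply/allpairsP => -[[w' a'] /= []].
  rewrite mem_growth_words => /andP[_ g'] _ /rcons_inj[e _].
  have := restricted_growth_mem g' k.+1.
  rewrite -e (restricted_growth_mem g) !mem_iota.
  by lia.
- case: k => // k; rewrite map_inj_uniq ?IH // => w w' /rcons_inj[//].
Qed.

(** * Partitions and restricted growth words *)

(** Exactly one block contains i, so [find] cannot stop before the block that
    contains it. *)
Lemma block_find n (P : {set {set 'I_n}}) (bs : seq {set 'I_n}) a i :
  partition P [set: 'I_n] -> bs =i P -> uniq bs -> a < size bs ->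
  (find (fun B : {set 'I_n} => i \in B) bs == a) = (i \in nth set0 bs a).
Proof.
move=> /and3P[/eqP cov tri _] bsP ubs lt_a.
have hasi : has (fun B : {set 'I_n} => i \in B) bs.
  have: i \in cover P by rewrite cov inE.
  by case/bigcupP=> B BP iB; apply/hasP; exists B; rewrite ?bsP.
have lt_f := hasi; rewrite has_find in lt_f.
have if_ := nth_find set0 hasi.
apply/eqP/idP => [<- //|ia]; apply/eqP.
rewrite -(nth_uniq set0 lt_f lt_a ubs); apply/eqP.
have inP b : b < size bs -> nth set0 bs b \in P by move=> ?; rewrite -bsP mem_nth.
by rewrite -(def_pblock tri (inP _ lt_f) if_) (def_pblock tri (inP _ lt_a) ia).
Qed.

Lemma mem_ordered_blocks n (P : {set {set 'I_n}}) : ordered_blocks P =i P.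
Proof. by move=> B; rewrite mem_sort mem_enum. Qed.

Lemma ordered_blocks_uniq n (P : {set {set 'I_n}}) : uniq (ordered_blocks P).
Proof. by rewrite sort_uniq enum_uniq. Qed.

Lemma size_ordered_blocks n (P : {set {set 'I_n}}) : size (ordered_blocks P) = #|P|.
Proof. by rewrite size_sort -cardE. Qed.

(** Strictness comes from disjointness: two blocks with the same least element
    share that element.  It makes the sorted list of blocks unique, although the
    relation used for sorting is not antisymmetric on arbitrary sets. *)
Lemma ordered_blocks_sorted n (P : {set {set 'I_n}}) :
  partition P [set: 'I_n] -> sorted ltn [seq block_min B | B <- ordered_blocks P].
Proof.
move=> /and3P[_ tri P0]; rewrite ltn_sorted_uniq_leq; apply/andP; split.
  rewrite map_inj_in_uniq ?ordered_blocks_uniq // => B C.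
  rewrite !mem_ordered_blocks => BP CP.
  have nz D : D \in P -> D != set0 by apply: contraTneq => ->.
  case: (block_min_mem (nz _ BP)) => i iB ->.
  case: (block_min_mem (nz _ CP)) => j jC -> /ord_inj ij.
  by rewrite -(def_pblock tri BP iB) ij (def_pblock tri CP jC).
by rewrite sorted_map; apply: sort_sorted => B C; apply: leq_total.
Qed.

Lemma ordered_blocks_eq n (P : {set {set 'I_n}}) (bs : seq {set 'I_n}) :
  partition P [set: 'I_n] -> bs =i P ->
  sorted ltn [seq block_min B | B <- bs] -> ordered_blocks P = bs.
Proof.
move=> partP bsP srt.
apply: (@irr_sorted_eq _ (relpre (@block_min n) ltn)) => [C B D|B|||B].
- exact: ltn_trans.
- exact: ltnn.
- by rewrite -sorted_map ordered_blocks_sorted.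
- by rewrite -sorted_map.
- by rewrite mem_ordered_blocks bsP.
Qed.

Lemma size_sequential_form n (P : {set {set 'I_n}}) : size (sequential_form P) = n.
Proof. by rewrite size_map size_enum_ord. Qed.

Lemma nth_sequential_form n (P : {set {set 'I_n}}) (i : 'I_n) :
  nth 0 (sequential_form P) i =
  (find (fun B : {set 'I_n} => i \in B) (ordered_blocks P)).+1.
Proof.
by rewrite (nth_map i) ?nth_ord_enum // size_enum_ord.
Qed.

(** The partition is recovered from its sequential form, as the list of its
    level sets in increasing order of labels. *)
Lemma level_set_sequential_form n (P : {set {set 'I_n}}) :
  partition P [set: 'I_n] ->
  [seq level_set n (sequential_form P) a | a <- iota 1 #|P|] = ordered_blocks P.
Proof.
move=> partP; apply: (@eq_from_nth _ set0).
  by rewrite size_map size_iota size_ordered_blocks.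
rewrite size_map size_iota => a lt_a; rewrite (nth_map 0) ?size_iota // nth_iota //.
apply/setP=> i; rewrite inE nth_sequential_form add1n eqSS.
apply: (block_find _ partP); first exact: mem_ordered_blocks.
  exact: ordered_blocks_uniq.
by rewrite size_ordered_blocks.
Qed.

Lemma sequential_form_growth n k (P : {set {set 'I_n}}) :
  P \in set_partitions n k -> sequential_form P \in growth_words n k.
Proof.
rewrite inE => /andP[partP /eqP kP]; rewrite mem_growth_words size_sequential_form eqxx /=.
have P0 : set0 \notin P by case/and3P: partP.
have lvl := level_set_sequential_form partP; rewrite kP in lvl.
have e : sequential_form P =i iota 1 k.
  move=> a; apply/idP/idP.
    case/(nthP 0) => i; rewrite size_sequential_form => lt_i <-.
    rewrite (nth_sequential_form P (Ordinal lt_i)) mem_iota add1n ltnS /=.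
    rewrite ltnS -kP -size_ordered_blocks -has_find.
    have: Ordinal lt_i \in cover P by case/and3P: partP => /eqP-> _ _; rewrite inE.
    by case/bigcupP=> B BP iB; apply/hasP; exists B; rewrite ?mem_ordered_blocks.
  move=> ak; have: level_set n (sequential_form P) a \in P.
    by rewrite -mem_ordered_blocks -lvl map_f.
  move=> LP; have: level_set n (sequential_form P) a != set0.
    by apply: contraNneq P0 => <-.
  case/set0Pn=> i; rewrite inE => /eqP <-.
  by rewrite mem_nth // size_sequential_form.
apply/restricted_growthP; split=> //.
suff -> : [seq index a (sequential_form P) | a <- iota 1 k] =
          [seq block_min B | B <- ordered_blocks P] by apply: ordered_blocks_sorted.
rewrite -lvl -map_comp; apply/eq_in_map => a; rewrite -e => aw /=.
by rewrite -block_min_level_set // size_sequential_form.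
Qed.

Lemma sequential_form_inj n k :
  {in set_partitions n k &, injective (@sequential_form n)}.
Proof.
move=> P Q; rewrite !inE => /andP[partP /eqP kP] /andP[partQ /eqP kQ] e.
apply/setP=> B; rewrite -!mem_ordered_blocks.
by rewrite -!level_set_sequential_form // e kP kQ.
Qed.

(** Given a word, the partition into its level sets works: the level sets taken
    in the order of the letters are sorted by least element, since the first
    occurrences of the letters are increasing. *)
Lemma growth_sequential_form n k w :
  w \in growth_words n k ->
  exists2 P, P \in set_partitions n k & sequential_form P = w.
Proof.
rewrite mem_growth_words => /andP[/eqP szw /restricted_growthP[e srt]].
pose bs := [seq level_set n w a | a <- iota 1 k].
have mins : [seq block_min B | B <- bs] = [seq index a w | a <- iota 1 k].
  rewrite -map_comp; apply/eq_in_map => a; rewrite -e => aw /=.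
  by rewrite -szw block_min_level_set.
have ubs : uniq bs.
  by apply: (@map_uniq _ _ (@block_min n)); rewrite mins (sorted_uniq ltn_trans ltnn).
pose P := [set B in bs].
have bsP : bs =i P by move=> B; rewrite inE.
have partP : partition P [set: 'I_n].
  apply/and3P; split.
  - apply/eqP/setP => i; rewrite [RHS]inE; apply/bigcupP.
    exists (level_set n w (nth 0 w i)); last by rewrite inE.
    by rewrite inE map_f // -e mem_nth // szw.
  - apply/trivIsetP => _ _ /[!inE] /mapP[a _ ->] /mapP[b _ ->] ne.
    rewrite -setI_eq0; apply: contraNT ne => /set0Pn[i]; rewrite !inE.
    by case/andP=> /eqP <- /eqP <-.
  - rewrite inE; apply/mapP => -[a]; rewrite -e => aw /setP.
    have lt_a : index a w < n by rewrite -szw index_mem.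
    by move/(_ (Ordinal lt_a)); rewrite !inE /= nth_index // eqxx.
have ob : ordered_blocks P = bs by apply: ordered_blocks_eq; rewrite // mins.
have kP : #|P| = k by rewrite -size_ordered_blocks ob size_map size_iota.
exists P; first by rewrite inE partP kP eqxx.
apply: (@eq_from_nth _ 0); rewrite size_sequential_form // => i lt_i.
rewrite (nth_sequential_form P (Ordinal lt_i)) ob.
have: nth 0 w i \in iota 1 k by rewrite -e mem_nth // szw.
rewrite mem_iota; case wi: (nth 0 w i) => [|a] //=; rewrite add1n ltnS => lt_a.
congr _.+1; apply/eqP; rewrite (block_find _ partP) //.
  by rewrite (nth_map 0) ?size_iota // nth_iota // inE /= wi.
by rewrite size_map size_iota.
Qed.

Lemma perm_sequential_form n k :
  perm_eq [seq sequential_form P | P <- enum (set_partitions n k)]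
          (growth_words n k).
Proof.
apply: uniq_perm; last 1 first.
- move=> w; apply/mapP/idP => [[P]|/growth_sequential_form[P PP <-]].
    by rewrite mem_enum => PP ->; apply: sequential_form_growth.
  by exists P; rewrite ?mem_enum.
- rewrite map_inj_in_uniq ?enum_uniq // => P Q; rewrite !mem_enum.
  exact: sequential_form_inj.
- exact: growth_words_uniq.
Qed.

Lemma stirling2_size n k : stirling2 n k = size (growth_words n k).
Proof. by rewrite -(perm_size (perm_sequential_form n k)) size_map -cardE. Qed.

Lemma total_occurrences_sum n k s :
  total_occurrences n k s = \sum_(w <- growth_words n k) occurrences s w.
Proof. by rewrite -(perm_big _ (perm_sequential_form n k)) /= big_map big_enum. Qed.

(** * Recurrences *)
Lemma stirling2_0 k : stirling2 0 k = (k == 0).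
Proof. by rewrite stirling2_size; case: k. Qed.

Lemma stirling2SS n k :
  stirling2 n.+1 k.+1 = k.+1 * stirling2 n k.+1 + stirling2 n k.
Proof.
by rewrite !stirling2_size growth_wordsSS size_cat size_allpairs size_iota size_map mulnC.
Qed.

Lemma stirling2_small n k : n < k -> stirling2 n k = 0.
Proof.
elim: n k => [|n IH] [|k] //; first by rewrite stirling2_0.
by rewrite ltnS stirling2SS => lt_nk; rewrite !IH ?muln0 // ltnW.
Qed.

Lemma big_growth_words n k (F : seq nat -> nat) :
  \sum_(w <- growth_words n.+1 k.+1) F w =
  \sum_(w <- growth_words n k.+1) \sum_(1 <= a < k.+2) F (rcons w a) +
  \sum_(w <- growth_words n k) F (rcons w k.+1).
Proof.
by rewrite growth_wordsSS big_cat big_allpairs_dep big_map /index_iota subn1.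
Qed.

Lemma occurrences_rcons s w a :
  occurrences s (rcons w a) =
  occurrences s w + ((w != [::]) && (a == last 0 w + s)).
Proof.
have occE v : occurrences s v =
    \sum_(i < (size v).-1) (nth 0 v i.+1 == nth 0 v i + s).
  rewrite /occurrences -sum1_card big_mkcond.
  by apply: eq_bigr => i _; rewrite inE; case: eqP.
rewrite !occE size_rcons; case: w => [|b w] /=; first by rewrite !big_ord0.
rewrite big_ord_recr /= nth_rcons ltnn eqxx -rcons_cons nth_rcons /= ltnS leqnn.
rewrite (last_nth 0); congr (_ + _); apply: eq_bigr => i _.
by rewrite -rcons_cons !nth_rcons ltn_ord /= (leqW (ltn_ord i)).
Qed.

Lemma sum_delta m n c : \sum_(m <= a < n) (a == c) = (m <= c < n).
Proof.
transitivity (\sum_(m <= a < n | a == c) 1); first by rewrite [RHS]big_mkcond.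
by rewrite sum1_count count_uniq_mem ?iota_uniq // mem_index_iota.
Qed.

(** Words counted here end with b - s, which is less than k because b <= k + 1
    and s >= 2.  Removing the last letter therefore leaves a word that still
    uses all k letters, and conversely any such word may be extended by
    b - s as soon as this is at least 1. *)
Lemma last_growth_words n k s b : 1 < s -> b <= k.+1 ->
  \sum_(w <- growth_words n.+1 k) (b == last 0 w + s) = (s < b) * stirling2 n k.
Proof.
move=> s2; case: k => [|k] b_k.
  rewrite growth_wordsS0 big_nil.
  by rewrite ltnNge (leq_trans b_k (ltnW s2)).
rewrite big_growth_words [X in _ + X]big1 => [|w _]; last first.
  by rewrite last_rcons; case: eqP; lia.
rewrite addn0 stirling2_size -iter_addn_0 -(count_predT (growth_words n k.+1)).
rewrite -(big_const_seq 0 addn) /=; apply: eq_bigr => w _.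
transitivity (\sum_(1 <= a < k.+2) ((s < b) && (a == b - s))).
  by apply: eq_big_nat => a a1; rewrite last_rcons; lia.
case: (ltnP s b) => [lt_sb|_]; last by rewrite big1.
by rewrite sum_delta; lia.
Qed.

Lemma total_occurrences1 k s : total_occurrences 1 k s = 0.
Proof.
rewrite total_occurrences_sum big_seq big1 // => w.
by rewrite mem_growth_words => /andP[/eqP sz _]; rewrite /occurrences sz eq_card0 // => -[].
Qed.

Lemma total_occurrencesS0 n s : total_occurrences n.+1 0 s = 0.
Proof.
by rewrite total_occurrences_sum growth_wordsS0 big_nil.
Qed.

(** Besides the occurrences inherited from the shorter word, each appended letter
    b creates one for every word ending with b - s: summed over the k + 1 old
    letters, this happens for those with b > s, and for the new letter b = k + 1
    when s <= k. *)
Lemma total_occurrencesSS n k s : 1 < s ->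
  total_occurrences n.+2 k.+1 s =
  k.+1 * total_occurrences n.+1 k.+1 s + total_occurrences n.+1 k s +
  (k.+1 - s) * stirling2 n k.+1 + (s <= k) * stirling2 n k.
Proof.
move=> s2; rewrite !total_occurrences_sum big_growth_words.
have nz l w : w \in growth_words n.+1 l -> (w != [::]).
  by rewrite mem_growth_words => /andP[/eqP sz _]; case: w sz.
have split l b : \sum_(w <- growth_words n.+1 l) occurrences s (rcons w b) =
    \sum_(w <- growth_words n.+1 l) occurrences s w +
    \sum_(w <- growth_words n.+1 l) (b == last 0 w + s).
  rewrite -big_split /= big_seq [RHS]big_seq; apply: eq_bigr => w /nz wn.
  by rewrite occurrences_rcons wn.
rewrite split last_growth_words // exchange_big /=.
rewrite (eq_big_nat _ _ (F2 := fun b =>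
    \sum_(w <- growth_words n.+1 k.+1) occurrences s w +
    (s < b) * stirling2 n k.+1)); last first.
  by move=> b /andP[_ lt_b]; rewrite split last_growth_words // ltnW.
rewrite big_split /= sum_nat_const_nat -big_distrl /= subn1 /= ltnS.
suff -> : \sum_(1 <= b < k.+2) (s < b) = k.+1 - s by lia.
elim: k {nz split} => [|k IH]; first by rewrite big_nat1; lia.
by rewrite big_nat_recr //= IH; lia.
Qed.

(** * The closed form *)

(** For 1 <= j <= k this is the number of pairs formed by a restricted growth word
    of length m - 1 on k letters and a cut of that word such that exactly j
    letters occur before the cut.  Its generating function is that of S(-, k)
    with the factor 1 / (1 - j x) occurring twice, which explains the
    convolution with the powers of j. *)
Definition split_words (m k j : nat) := \sum_(t < m) stirling2 (m - t.+1) k * j ^ t.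

Lemma split_wordsS m k j :
  split_words m.+1 k j = stirling2 m k + j * split_words m k j.
Proof.
rewrite /split_words big_ord_recl subn1 muln1 big_distrr /=; congr (_ + _).
by apply: eq_bigr => t _; rewrite /bump /= add1n subSS expnS mulnCA.
Qed.

Lemma split_wordsSS m k j :
  split_words m.+1 k.+1 j =
  k.+1 * split_words m k.+1 j + split_words m k j.
Proof.
rewrite {1}/split_words big_ord_recr /= subnn stirling2_0 addn0.
rewrite /split_words big_distrr -big_split /=; apply: eq_bigr => t _.
by rewrite subSS -subnSK ?ltn_ord // stirling2SS; ring.
Qed.

Lemma total_occurrences_split m k s : 1 < s ->
  total_occurrences m.+1 k s =
  (k - s) * stirling2 m k + \sum_(s.+1 <= j < k.+1) (j - s) * split_words m k j.
Proof.
move=> s2; elim: m k => [|m IH] k.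
  rewrite total_occurrences1 stirling2_0 big1 => [|j _]; last first.
    by rewrite /split_words big_ord0 muln0.
  by case: k => [|k]; rewrite ?sub0n ?muln0.
case: k => [|k]; first by rewrite total_occurrencesS0 big_geq.
rewrite total_occurrencesSS // !IH stirling2SS.
case: (leqP s k) => [le_sk|lt_ks]; last first.
  by rewrite !big_geq; lia.
(* For j = k + 1 the term split_words m k j is absent from the sum given by the
   induction hypothesis at k, so that summand is expanded by split_wordsS, which
   keeps k + 1 letters, and only the others by split_wordsSS. *)
rewrite !(@big_nat_recr _ _ _ k.+1) //= split_wordsS.
have -> : \sum_(s.+1 <= j < k.+1) (j - s) * split_words m.+1 k.+1 j =
  k.+1 * (\sum_(s.+1 <= j < k.+1) (j - s) * split_words m k.+1 j)
  + \sum_(s.+1 <= j < k.+1) (j - s) * split_words m k j.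
  rewrite big_distrr -big_split /=; apply: eq_bigr => j _.
  by rewrite split_wordsSS; ring.
rewrite subSn //; ring.
Qed.

Theorem corollary4p2 (n k s : nat) (hs : 2 <= s) (hk : s + 1 <= k)
    (hn : k + 1 <= n) :
  total_occurrences n k s =
    (k - s) * stirling2 (n - 1) k +
    \sum_(s + 1 <= j < k + 1) \sum_(0 <= t < n - k - 1)
      stirling2 (n - t - 2) k * j ^ t * (j - s).
Proof.
case: n hn => [|m] hn; first by lia.
rewrite total_occurrences_split // subn1 /= !addn1; congr (_ + _).
apply: eq_bigr => j _; rewrite /split_words.
rewrite -(big_mkord xpredT (fun t => stirling2 (m - t.+1) k * j ^ t)).
(* From t = n - k - 1 on, the Stirling number has fewer elements than blocks. *)
rewrite (@big_cat_nat _ _ _ (m.+1 - k - 1)) //=; last by lia.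
rewrite [X in _ * (_ + X)]big_nat [X in _ * (_ + X)]big1 => [|t Ht]; last first.
  by rewrite stirling2_small //; lia.
rewrite addn0 big_distrr /=; apply: eq_bigr => t _.
by rewrite mulnC; congr (stirling2 _ _ * _ * _); lia.
Qed.
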